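(* Let $T$ be a rooted (order-theoretic) tree. The following are equivalent: (a) $\mathcal R(T)$ is Rothberger. (b) $\mathcal R(T)$ is Lindelöf and contains no topological copy of the Cantor space. (c) $\mathcal R(T)$ is Lindelöf and $T$ contains no subset which is order-isomorphic to the binary tree $2^{<\omega}$. (d) $\mathcal R(T)$ is Lindelöf and scattered. Moreover, if $T$ is a pruned tree, then the condition ''$\mathcal R(T)$ is Lindelöf'' in all the items where it occurs may be replaced by ''every node of $T$ has at most countably many (immediate) successors''.
   Context: An order-theoretic tree is a partially ordered set $(T,<)$ such that for every $t\in T$ the set $\{s\in T: s<t\}$ is well-ordered by $<$. It is rooted if it has a least element (the root). A ray of $T$ is a nonempty downward closed chain $R\subseteq T$ with no maximal element (it need not be a maximal chain). $T$ is pruned if every node of $T$ belongs to some ray of $T$. The ray space $\mathcal R(T)$ is the set of all rays of $T$, topologized as a subspace of $\mathcal P(T)\cong 2^T$ with the product topology; i.e. a subbasis is given by the sets $[t]=\{R\in\mathcal R(T): t\in R\}$ and $\mathcal R(T)\setminus[t]$, for $t\in T$. $2^{<\omega}$ is the set of finite $0$-$1$ sequences ordered by extension; the Cantor space is $2^\omega$ with the product topology. A subset of $T$ is given the induced order. A space $X$ is Rothberger if for every sequence $(\mathcal U_n:n\in\omega)$ of open covers of $X$ there are $U_n\in\mathcal U_n$ with $X=\bigcup_{n\in\omega}U_n$ (open covers are understood to be nonempty families, so that the empty space is Rothberger). $X$ is Lindelöf if every open cover has a countable subcover. $X$ is scattered if every nonempty subset of $X$ has an isolated point (in the subspace topology).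 *)

(* Defs.v *)
From mathcomp Require Import all_boot all_order.
From mathcomp Require Import wochoice all_classical.
From mathcomp Require Import topology cantor.

Set Implicit Arguments.
Unset Strict Implicit.
Unset Printing Implicit Defensive.

Import Order.TTheory.
Local Open Scope classical_set_scope.
Local Open Scope order_scope.

Section Trees.
Context {d : Order.disp_t} (T : porderType d).

(* [wo_chain] quantifies over boolean predicates; classically ([asbool]) these
   are all the subsets of T. *)
Definition order_tree : Prop :=
  forall t : T, wo_chain <=%O [pred s : T | s < t].

Definition rooted : Prop := exists r : T, forall t : T, r <= t.

Definition is_ray (R : set T) : Prop :=
  [/\ R !=set0,
      forall s t : T, s <= t -> R t -> R s,
      total_on R (fun s t : T => s <= t) &
      forall t : T, R t -> exists2 s : T, R s & t < s].

Definition pruned : Prop :=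
  forall t : T, exists R : set T, is_ray R /\ R t.

(* A subset of T is encoded by its indicator function, a point of the product
   2^T of copies of the discrete space bool. *)
Definition rays : set {ptws T -> bool} :=
  [set R | is_ray [set t | R t]].

(* The carrier is the subtype [set_type rays]: it has the subspace topology. *)
Definition ray_space : topologicalType := rays.

Definition immediate_successors (t : T) : set T :=
  [set s | t < s /\ ~ exists u : T, t < u < s].

Definition countably_branching : Prop :=
  forall t : T, countable (immediate_successors t).

(* 2^{<omega} is [seq bool] ordered by [prefix]. *)
Definition contains_binary_tree : Prop :=
  exists (A : set T) (f : seq bool -> T),
    set_bij [set: seq bool] A f /\
    {mono f : s t / prefix s t >-> s <= t}.

End Trees.

Section Spaces.
Context (X : topologicalType).

Definition open_cover (U : set (set X)) : Prop :=
  [/\ U !=set0, U `<=` open & \bigcup_(A in U) A = [set: X]].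

Definition rothberger : Prop :=
  forall U : nat -> set (set X), (forall n, open_cover (U n)) ->
  exists V : nat -> set X,
    (forall n, U n (V n)) /\ \bigcup_n V n = [set: X].

Definition lindelof : Prop :=
  forall U : set (set X), open_cover U ->
  exists V : set (set X),
    [/\ V `<=` U, countable V & \bigcup_(A in V) A = [set: X]].

Definition scattered : Prop :=
  forall A : set X, A !=set0 -> isolated A !=set0.

(* f is a homeomorphism onto its range. *)
Definition topological_embedding (Y : topologicalType) (f : Y -> X) : Prop :=
  [/\ injective f, continuous f &
      forall U : set Y, open U ->
      exists2 V : set X, open V & f @` U = V `&` range f].

Definition contains_copy_of (Y : topologicalType) : Prop :=
  exists f : Y -> X, topological_embedding f.

End Spaces.

(* Main.v *)
Require Import Defs.
From mathcomp Require Import all_boot all_order all_classical topology cantor.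
From mathcomp Require Import wochoice.

(** Each arrow of the cycle (a) => (b) => (c) => (d) => (a) is either general
    topology or a short construction with rays.

    (a) => (b): a constant sequence of covers shows that a Rothberger space is
    Lindelöf.  A Cantor set K in a Hausdorff space X defeats the Rothberger
    property: let the n-th cover consist of the open sets meeting K only in
    points with the same n-th digit.  Any selection is missed by the point of
    K whose digits all disagree with those selected
    ([rothberger_no_cantor]).

    (b) => (c): an order embedding f of the binary tree into T sends an
    infinite branch x to the ray generated by the nodes f(x|n).  Distinct
    branches give incomparable nodes, hence distinct rays; this map is
    continuous, and an injective continuous map from a compact space to a
    Hausdorff one is an embedding ([binary_tree_contains_cantor]).

    (c) => (d): let A be a nonempty set of rays.  If above every node lying on
    a ray of A there are two incomparable such nodes, iterating the choice
    gives a binary tree.  Otherwise the rays of A through some node t run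
    through a common well-ordered chain; the least node u at which two of them
    separate isolates, by the clopen set of rays containing t but not u, the
    only ray of A in this set; if no two of them separate, [t] already isolates
    a ray of A ([no_binary_tree_scattered]).

    (d) => (a): in a regular Lindelöf scattered space let W be the union of
    the open sets that are Rothberger relative to the covers of the whole
    space.  An isolated point p of the complement of W would have a closed
    neighbourhood contained in W except for p; one selected set covers p, and
    what remains is a closed, hence Lindelöf, subset of W, hence Rothberger.
    This puts p into W, so W is everything
    ([regular_lindelof_scattered_rothberger]).

    For the second half, in a pruned tree the disjoint nonempty open sets [s],
    for s an immediate successor of t, together with the complement of [t]
    form a cover from which no [s] can be dropped, so Lindelöf gives countable
    branching.  Conversely, suppose that T is countably branching and that some
    open cover has no countable subcover.  Call t bad if [t] is not countably
    covered.  The root is bad, and every bad node has a bad immediate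
    successor, so a maximal chain of bad nodes is a ray.  A member of the cover
    containing this ray leaves over, above some node of it, only finitely many
    sets [s] with s off the ray, and these are countably covered near the ray
    because no node above the whole ray is bad
    ([countably_branching_lindelof]). *)

Set Implicit Arguments.
Unset Strict Implicit.
Unset Printing Implicit Defensive.
Import Order.TTheory.
Local Open Scope order_scope.
Local Open Scope classical_set_scope.

(** * Rothberger spaces *)

Section RelativeCovers.
Context (X : topologicalType).
Implicit Types (A B : set X) (U : set (set X)).

(** The covers are covers of the whole space: this makes the property pass to
    arbitrary subsets. *)
Definition rothberger_in A : Prop :=
  forall U : nat -> set (set X), (forall n, open_cover (U n)) ->
  exists V : nat -> set X, (forall n, U n (V n)) /\ A `<=` \bigcup_n V n.

Lemma sub_rothberger_in A B : A `<=` B -> rothberger_in B -> rothberger_in A.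
Proof.
by move=> AB rB U /rB[V [UV BV]]; exists V; split=> //; exact: subset_trans BV.
Qed.

Lemma rothberger_in0 : rothberger_in set0.
Proof.
move=> U cU; have /choice[V UV] : forall n, exists B, U n B.
  by move=> n; case: (cU n).
by exists V; split.
Qed.

(** The sequence of covers is split, along an injection of nat * nat in nat,
    into countably many sequences, one for each of the sets to be covered. *)
Lemma rothberger_in_bigcup (I : Type) (D : set I) (F : I -> set X) :
  countable D -> (forall i, D i -> rothberger_in (F i)) ->
  rothberger_in (\bigcup_(i in D) F i).
Proof.
move=> /countable_injP[e injE] rF U cU.
have /choice[W WP] : forall k, exists W : nat -> set X,
    (forall n, U (pickle (k, n)) (W n)) /\
    forall i, D i -> e i = k -> F i `<=` \bigcup_n W n.
  move=> k; have [[i Di ei]|nD] := pselect (exists2 i, D i & e i = k).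
    have [W [UW FW]] := rF i Di (fun n => U (pickle (k, n))) (fun n => cU _).
    exists W; split=> // j Dj ej; have -> // : j = i.
    by apply: injE; rewrite ?inE// ej.
  have [W [UW _]] := rothberger_in0 (fun n => cU (pickle (k, n))).
  by exists W; split=> // i Di ei; case: nD; exists i.
have /choice[V VP] : forall m, exists A,
    U m A /\ forall k n, m = pickle (k, n) -> A = W k n.
  move=> m; have [[[k n] mE]|nm] := pselect (exists p : nat * nat, m = pickle p).
    exists (W k n); split; first by rewrite mE; exact: (WP k).1.
    by move=> k' n'; rewrite mE => /(pcan_inj pickleK)[-> ->].
  case: (cU m) => -[A UA] _ _; exists A; split=> // k n mE.
  by case: nm; exists (k, n).
exists V; split=> [m|x [i Di Fx]]; first exact: (VP m).1.
have [n _ Wx] := (WP (e i)).2 i Di erefl x Fx.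
by exists (pickle (e i, n)) => //; rewrite ((VP _).2 (e i) n erefl).
Qed.

(** The open Rothberger subsets cover the space: an isolated point p of what
    they leave out could be absorbed, by spending one set of the selection on p
    and the others on the rest of a small closed neighbourhood of p. *)
Theorem regular_lindelof_scattered_rothberger :
  regular_space X -> lindelof X -> scattered X -> rothberger X.
Proof.
move=> regX lindX scatX.
pose G := [set B : set X | open B /\ rothberger_in B].
suff GT : \bigcup_(B in G) B = [set: X].
  have [|V [VG cV VT]] := lindX G.
    split=> //; last by move=> B [].
    by exists set0; split; [exact: open0|exact: rothberger_in0].
  move=> U cU; have rT : rothberger_in (\bigcup_(B in V) B).
    by apply: rothberger_in_bigcup => // B /VG[].
  have [S [US TS]] := rT U cU.
  by exists S; split=> //; rewrite -subTset -VT.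
apply: contrapT => GnT.
have [|p [/set_mem Gp [O Op Oiso]]] := scatX (~` \bigcup_(B in G) B).
  by apply/set0P/eqP => /(congr1 (@setC X)); rewrite setCK setC0.
(* N° is a new open Rothberger subset around p. *)
have [N Np NO] := regX p O Op.
apply: (Gp); exists N°; last by [].
split; first exact: open_interior.
move=> U cU; have [_ oU0 U0T] := cU 0.
have [V0 UV0 V0p] : (\bigcup_(A in U 0) A) p by rewrite U0T.
pose K := closure N `&` ~` V0.
have Kcl : closed K.
  by apply: closedI; [exact: closed_closure|exact/open_closedC/oU0].
(* K avoids p and lies in O, so it is covered by open sets in G; as K is closed,
   the Lindelöf property of X applies to it through the open set ~` K. *)
have Kr : rothberger_in K.
  have [|V [VC cV VT]] := lindX [set B | open B /\ rothberger_in (B `&` K)].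
    have Cn : open (~` K) /\ rothberger_in (~` K `&` K).
      split; first exact: closed_openC.
      by rewrite setICl; exact: rothberger_in0.
    split; [by exists (~` K)|by move=> B []|].
    rewrite -subTset => x _; have [Kx|nKx] := pselect (K x); last by exists (~` K).
    have [B [oB rB] Bx] : (\bigcup_(B in G) B) x.
      apply: contrapT => Gx; have : (O `&` ~` \bigcup_(B in G) B) x.
        by split=> //; apply: NO; case: Kx.
      by rewrite Oiso => xp; case: Kx => _; rewrite xp.
    by exists B => //; split=> //; apply: sub_rothberger_in rB => ? [].
  have : rothberger_in (\bigcup_(B in V) (B `&` K)).
    by apply: rothberger_in_bigcup => // B /VC[].
  by rewrite -setI_bigcupl VT setTI.
have [V [UV KV]] := Kr (fun n => U n.+1) (fun n => cU n.+1).
exists (fun n => if n is m.+1 then V m else V0); split=> [[|m]//|x Nx].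
have [V0x|nV0x] := pselect (V0 x); first by exists 0.
have [|m _ Vx] := KV x; last by exists m.+1.
by split=> //; apply: subset_closure; exact: interior_subset Nx.
Qed.

Lemma rothberger_lindelof : rothberger X -> lindelof X.
Proof.
move=> rX U cU; have [V [UV VT]] := rX (fun=> U) (fun=> cU).
exists (range V); split.
- by move=> _ [n _ <-].
- exact: sub_countable (card_image_le _ _) (countableP _).
- by rewrite bigcup_image.
Qed.

(** A diagonal argument: the n-th cover consists of the open sets that decide the
    n-th digit of the points of the Cantor set.  Compactness and the Hausdorff
    property make the Cantor set closed, so that its complement is such a set. *)
Theorem rothberger_no_cantor : hausdorff_space X -> rothberger X ->
  ~ contains_copy_of X cantor_space.
Proof.
move=> hX rX [f [injf contf embf]].
have clf : closed (range f).
  apply: compact_closed => //; apply: continuous_compact.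
    exact: continuous_subspaceT.
  exact: cantor_space_compact.
pose U n := [set V : set X | open V /\
  exists b : bool, forall x : cantor_space, V (f x) -> x n = b].
have cU n : open_cover (U n).
  split=> [|V []//|].
    by exists set0; split; [exact: open0|exists true].
  rewrite -subTset => y _; have [[x _ <-]|ny] := pselect (range f y); last first.
    exists (~` range f) => //; split; first exact: closed_openC.
    by exists true => x []; exists x.
  have [|V oV] := embf [set z : cantor_space | z n = x n].
    have -> : [set z : cantor_space | z n = x n] = (proj n) @^-1` [set x n] by [].
    apply: (@open_comp cantor_space bool); last exact: discrete_open.
    by move=> z _; exact: proj_continuous.
  (* The intersection here is the meet in the lattice of subsets of X. *)
  rewrite -[RHS]/(V `&` range f) => VE.
  have Vf z : V (f z) -> z n = x n.
    move=> Vfz; have : (V `&` range f) (f z) by split=> //; exists z.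
    by rewrite -VE => -[z' /= z'n /injf <-].
  exists V; first by split=> //; exists (x n).
  have : (f @` [set z : cantor_space | z n = x n]) (f x) by exists x.
  by rewrite VE => -[].
have [V [UV VT]] := rX U cU.
have /choice[b bP] : forall n, exists b : bool,
    forall x : cantor_space, V n (f x) -> x n = b by move=> n; case: (UV n).
have [n _ Vn] : (\bigcup_n V n) (f (fun n => ~~ b n)) by rewrite VT.
by have := bP n _ Vn => /=; case: (b n).
Qed.

End RelativeCovers.

(** * Countable covers *)

Section CountableCovers.
Context (X : topologicalType).
Implicit Types (A B : set X) (U : set (set X)).

Definition countably_covered U A : Prop :=
  exists V : set (set X), [/\ V `<=` U, countable V & A `<=` \bigcup_(B in V) B].

Lemma countably_covered0 U : countably_covered U set0.
Proof. by exists set0; split. Qed.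

Lemma countably_covered1 U A : U A -> countably_covered U A.
Proof. by move=> UA; exists [set A]; split=> [B ->||x Ax] //; exists A. Qed.

Lemma sub_countably_covered U A B :
  A `<=` B -> countably_covered U B -> countably_covered U A.
Proof.
by move=> AB [V [VU cV BV]]; exists V; split=> //; exact: subset_trans BV.
Qed.

Lemma countably_covered_bigcup U (I : Type) (D : set I) (F : I -> set X) :
  countable D -> (forall i, D i -> countably_covered U (F i)) ->
  countably_covered U (\bigcup_(i in D) F i).
Proof.
move=> cD cF; have /choice[V VP] : forall i, exists V : set (set X), D i ->
    [/\ V `<=` U, countable V & F i `<=` \bigcup_(B in V) B].
  move=> i; have [Di|nDi] := pselect (D i); last by exists set0.
  by have [V VP] := cF i Di; exists V.
exists (\bigcup_(i in D) V i); split.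
- by move=> B [i /VP[VU _ _] /VU].
- by apply: bigcup_countable => // i /VP[].
- move=> x [i Di Fx]; have [_ _ FV] := VP i Di.
  by have [B VB Bx] := FV x Fx; exists B => //; exists i.
Qed.

Lemma countably_coveredU U A B : countably_covered U A ->
  countably_covered U B -> countably_covered U (A `|` B).
Proof.
move=> cA cB; rewrite -bigcup2E.
apply: countably_covered_bigcup => // -[|[|n]] _ //=.
exact: countably_covered0.
Qed.

End CountableCovers.

(** * Order-theoretic trees *)

Section TreeOrder.
Context {d : Order.disp_t} (T : porderType d) (treeT : order_tree T).
Implicit Types (s t u : T) (C : set T).

Lemma tree_comparable u s t : s <= u -> t <= u -> s <= t \/ t <= s.
Proof.
rewrite !le_eqVlt => /predU1P[->|su] /predU1P[->|tu]; rewrite ?eqxx ?tu ?su ?orbT;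
  try by [left|right].
by apply/orP; rewrite -!le_eqVlt; exact: (wo_chainW (treeT (t := u))).
Qed.

(** Only the strict down-sets of the tree are assumed to be well ordered; in a
    chain, the nodes below a given member form such a set. *)
Lemma chain_least C : C !=set0 -> total_on C (fun s t => s <= t) ->
  exists2 m, C m & forall s, C s -> m <= s.
Proof.
move=> [c Cc] totC; have [[b [Cb bc]]|nb] := pselect (exists b, C b /\ b < c).
  have [||m [[mA mle] _]] := treeT (t := c) (A := [pred s | `[< C s >] && (s < c)]).
  - by move=> s /andP[].
  - by exists b; apply/andP; split; first exact/asboolP.
  have /andP[/asboolP Cm mc] := mA; exists m => // s Cs.
  have [sc|cs] := totC s c Cs Cc; last exact: le_trans (ltW mc) cs.
  move: sc; rewrite le_eqVlt => /predU1P[->|sc]; first exact: ltW.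
  by apply: mle; apply/andP; split; first exact/asboolP.
exists c => // s Cs; have [sc|//] := totC s c Cs Cc.
move: sc; rewrite le_eqVlt => /predU1P[->//|sc].
by case: nb; exists s.
Qed.

Lemma ray_immediate_successor C t : is_ray C -> C t ->
  exists2 s, C s & immediate_successors t s.
Proof.
move=> [_ downC totC nomaxC] Ct.
have [||s [Cs ts] sle] := @chain_least [set s | C s /\ t < s].
- by have [s Cs ts] := nomaxC t Ct; exists s.
- by move=> s u [Cs _] [Cu _]; exact: totC.
exists s => //; split=> // -[u /andP[tu us]].
have /sle : C u /\ t < u by split=> //; exact: downC (ltW us) Cs.
by move/(lt_le_trans us); rewrite ltxx.
Qed.

Lemma comparable_immediate_successors t s u :
  immediate_successors t s -> immediate_successors t u ->
  s <= u \/ u <= s -> s = u.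
Proof.
move=> [ts ns] [tu nu] [|]; rewrite le_eqVlt => /predU1P[//|lt].
- by case: nu; exists s; rewrite ts lt.
- by case: ns; exists u; rewrite tu lt.
Qed.

(** The embedding maps a word to the node reached by following its letters, where
    the two letters lead to incomparable nodes of P above the current one. *)
Lemma splitting_contains_binary_tree (P : set T) : P !=set0 ->
  (forall t, P t -> exists s0 s1, [/\ P s0, P s1, t <= s0, t <= s1 &
     ~ (s0 <= s1 \/ s1 <= s0)]) ->
  contains_binary_tree T.
Proof.
move=> [t0 Pt0] splitP.
have /choice[g gP] : forall t, exists h : bool -> T, P t ->
    [/\ forall b, P (h b), forall b, t < h b &
        ~ (h false <= h true \/ h true <= h false)].
  move=> t; have [Pt|nPt] := pselect (P t); last by exists (fun=> t).
  have [s0 [s1 [P0 P1 ts0 ts1 inc]]] := splitP t Pt.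
  exists (fun b => if b then s1 else s0) => _; split=> //; first by case.
  case; rewrite lt_neqAle ?ts0 ?ts1 andbT; apply/eqP => tE; apply: inc.
  - by right; rewrite -tE.
  - by left; rewrite -tE.
have foldP (s : seq bool) t : P t -> P (foldl g t s) /\ t <= foldl g t s.
  elim: s t => [|a s IH] t Pt //=; have [Pg ltg _] := gP t Pt.
  have [Pf lef] := IH _ (Pg a); split=> //.
  exact: le_trans (ltW (ltg a)) lef.
have mono (s u : seq bool) t : P t -> (foldl g t s <= foldl g t u) = prefix s u.
  elim: s u t => [|a s IH] [|b u] t Pt //; have [Pg ltg inc] := gP t Pt.
  - by rewrite lexx.
  - by rewrite prefix0s; exact: (foldP (b :: u) t Pt).2.
  - apply/negbTE/negP => /= le; have := le_trans (foldP s _ (Pg a)).2 le.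
    by move/(lt_le_trans (ltg a)); rewrite ltxx.
  (* Where the words part, the two nodes are incomparable; the order relation
     would put both of them below a common node. *)
  rewrite prefix_cons; have [<-|ab] := eqVneq a b; first by rewrite /= IH.
  apply/negbTE/negP => /= le.
  have lea := le_trans (foldP s _ (Pg a)).2 le.
  have := tree_comparable lea (foldP u _ (Pg b)).2.
  by case: a b ab {le lea} => -[] // _ c; apply: inc; case: c; auto.
exists (range (foldl g t0)), (foldl g t0); split; last first.
  by move=> s u; exact: mono.
split=> [s _||//]; first by exists s.
move=> s u _ _ E.
have su : prefix s u by rewrite -(mono _ _ t0) // E.
have us : prefix u s by rewrite -(mono _ _ t0) // E.
have sz : size s = size u by apply/eqP; rewrite eqn_leq !size_prefix.
by move: su; rewrite prefixE sz take_size => /eqP.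
Qed.

End TreeOrder.

(** * The topology of the ray space *)

Section RaySpace.
Context {d : Order.disp_t} (T : porderType d).
Implicit Types (s t u : T) (C : set T) (R : ray_space T).

Definition nodes R : set T := [set t | \val R t].

Definition cone t : set (ray_space T) := [set R | nodes R t].

Lemma nodes_is_ray R : is_ray (nodes R).
Proof. by have /set_mem := valP R. Qed.

Lemma nodes_inj : injective nodes.
Proof.
move=> R R' /seteqP[RR' R'R]; apply: val_inj; apply/funext => t.
by apply/idP/idP => [/RR'|/R'R].
Qed.

Lemma is_ray_nodes C : is_ray C -> exists R, nodes R = C.
Proof.
move=> rayC; pose c : {ptws T -> bool} := fun t => `[< C t >].
have cE : [set t | c t] = C by apply/seteqP; split=> t /asboolP.
have rc : c \in @rays d T by rewrite inE /rays /= cE.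
by exists (exist _ c rc).
Qed.

(** The topology is that of pointwise convergence of indicator functions, so
    only the values at single nodes matter. *)
Lemma cvg_ray (F : set_system (ray_space T)) (FF : Filter F) R :
  (forall t, nodes R t -> F (cone t)) ->
  (forall t, ~ nodes R t -> F (~` cone t)) -> F --> R.
Proof.
move=> Fin Fout O [_ [[W oW <-] WR WO]].
suff FW : \val @ F --> (\val R : {ptws T -> bool}).
  by apply: filterS WO _; apply: FW; exact: open_nbhs_nbhs.
apply/cvg_sup => t B [_ [[D oD <-] DR DB]].
have Rt : F [set R' | \val R' t = \val R t].
  have [Rt|nRt] := pselect (nodes R t).
    by apply: filterS (Fin t Rt) => R'; rewrite /cone /nodes /= => ->.
  apply: filterS (Fout t nRt) => R' /negP/negbTE.
  by move/negP/negbTE : nRt => ->.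
suff : F (\val @^-1` B) by [].
apply: filterS Rt => R' E; apply: DB.
by rewrite /proj /= E.
Qed.

Lemma cone_open t : open (cone t).
Proof.
exists [set f : {ptws T -> bool} | f t = true]; last by [].
apply: (@open_comp {ptws T -> bool} bool (proj t) [set true]).
  by move=> z _; exact: proj_continuous.
exact: discrete_open.
Qed.

Lemma setC_cone_open t : open (~` cone t).
Proof.
exists [set f : {ptws T -> bool} | f t = false].
  apply: (@open_comp {ptws T -> bool} bool (proj t) [set false]).
    by move=> z _; exact: proj_continuous.
  exact: discrete_open.
by apply/seteqP; split=> R; [move=> /= /negbT/negP | move=> /negP/negbTE].
Qed.

Lemma ray_continuous (Y : topologicalType) (f : Y -> ray_space T) :
  (forall t, open (f @^-1` cone t)) -> (forall t, open (f @^-1` (~` cone t))) ->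
  continuous f.
Proof.
move=> oin oout y; apply: cvg_ray => t tP; apply: open_nbhs_nbhs.
- by split; [exact: oin|].
- by split; [exact: oout|].
Qed.

(** Basic neighbourhoods need only one positive condition: of finitely many nodes
    on a ray, the largest one implies the others. *)
Lemma nbhs_ray R O : nbhs R O -> exists t, nodes R t /\
  exists2 l : seq T, (forall s, s \in l -> ~ nodes R s) &
    forall R', nodes R' t -> (forall s, s \in l -> ~ nodes R' s) -> O R'.
Proof.
pose I := [set p : T * seq T | nodes R p.1 /\ forall s, s \in p.2 -> ~ nodes R s].
pose box (p : T * seq T) :=
  [set R' | nodes R' p.1 /\ forall s : T, s \in p.2 -> ~ nodes R' s].
have [[r0 Rr0] _ totR _] := nodes_is_ray R.
(* The boxes generate a filter which converges to R by the pointwise criterion,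
   hence contains all the neighbourhoods of R. *)
have FF : Filter (filter_from I box).
  apply: filter_from_filter; first by exists (r0, [::]).
  move=> [t l] [t' l'] [/= Rt Rl] [/= Rt' Rl'].
  have out s : s \in l ++ l' -> ~ nodes R s.
    by rewrite mem_cat => /orP[/Rl|/Rl'].
  wlog tt' : t t' l l' Rt Rt' Rl Rl' out / t <= t'.
    have [tt'|t't] := totR t t' Rt Rt'; first exact.
    move=> /(_ t' t l' l)[]// => [s|p Ip pB].
      by rewrite mem_cat orbC -mem_cat; exact: out.
    by exists p => //; rewrite setIC.
  exists (t', l ++ l') => // R' [/= R't' nR'].
  have [_ downR' _ _] := nodes_is_ray R'.
  split; split=> //=; last 1 first.
  - by move=> s sl; apply: nR'; rewrite mem_cat sl orbT.
  - exact: downR' R't'.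
  - by move=> s sl; apply: nR'; rewrite mem_cat sl.
have cvgR : filter_from I box --> R.
  apply: cvg_ray => t tP.
    by exists (t, [::]) => // R' [].
  exists (r0, [:: t]); last by move=> R' [_ /(_ t)]; apply; rewrite mem_head.
  by split=> // s; rewrite inE => /eqP ->.
move=> /cvgR[[t l] [/= Rt Rl] bO]; exists t; split=> //; exists l => // R' R't R'l.
by apply: bO.
Qed.

Lemma ray_space_hausdorff : hausdorff_space (ray_space T).
Proof.
rewrite open_hausdorff => R R' RR'.
have sep (R1 R2 : ray_space T) t : nodes R1 t -> ~ nodes R2 t ->
    exists2 AB, (R1 \in AB.1 /\ R2 \in AB.2) &
      [/\ open AB.1, open AB.2 & AB.1 `&` AB.2 == set0].
  move=> R1t R2t; exists (cone t, ~` cone t); first by rewrite !inE.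
  by split; [exact: cone_open|exact: setC_cone_open|rewrite setICr].
have [[t [Rt R't]]|n1] := pselect (exists t, nodes R t /\ ~ nodes R' t).
  exact: sep Rt R't.
have [[t [R't Rt]]|n2] := pselect (exists t, nodes R' t /\ ~ nodes R t).
  have [[A B] /= [AR BR] [oA oB AB]] := sep _ _ _ R't Rt.
  by exists (B, A); split=> //=; rewrite setIC.
case/eqP: RR'; apply: nodes_inj; apply/seteqP; split=> t tR; apply: contrapT => tn.
- by apply: n1; exists t.
- by apply: n2; exists t.
Qed.

Lemma ray_space_regular : regular_space (ray_space T).
Proof. exact: (@uniform_regular (@rays d T)). Qed.

End RaySpace.

(** * Rays in a tree *)

Section RayTree.
Context {d : Order.disp_t} (T : porderType d) (treeT : order_tree T).
Implicit Types (s t u : T) (R : ray_space T).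

(** Maximality takes the form in which it is used: the chain absorbs every node of B
    that is comparable with all its members. *)
Lemma maximal_chain_in (B : set T) : exists M : set T,
  [/\ M `<=` B, total_on M (fun s t => s <= t) &
      forall t, B t -> (forall s, M s -> s <= t \/ t <= s) -> M t].
Proof.
pose P (C : set T) := C `<=` B /\ total_on C (fun s t => s <= t).
have [|M [[MB Mtot] Mmax]] := @Zorn_bigcup T P.
  move=> F FP Ftot; split; first by apply: bigcup_sub => C /FP[].
  move=> s t [C FC Cs] [D FD Dt]; have [CD|DC] := Ftot C D FC FD.
  - by apply: (FP D FD).2 => //; exact: CD.
  - by apply: (FP C FC).2 => //; exact: DC.
exists M; split=> // t Bt tM; apply: contrapT => nMt.
apply: (Mmax (M `|` [set t])); last split.
- by split=> [s|sub]; [left|apply: nMt; apply: sub; right].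
- by move=> s [/MB|->].
- move=> s u [Ms|->] [Mu|->]; [exact: Mtot|exact: tM| |by left].
  by have [us|su] := tM u Mu; [right|left].
Qed.

Lemma nodes_down R s t : s <= t -> nodes R t -> nodes R s.
Proof. by have [_ downR _ _] := nodes_is_ray R; exact: downR. Qed.

Lemma nodes_total R s t : nodes R s -> nodes R t -> s <= t \/ t <= s.
Proof. by have [_ _ totR _] := nodes_is_ray R; exact: totR. Qed.

(** A branch x of the binary tree is sent to the ray generated by the nodes
    f(x|n).  The preimage of [t] is open since membership of t is witnessed by
    one f(x|n).  It is closed: if t is off the ray of x, then either some f(x|n)
    is incomparable with t, which excludes t from the rays of all the branches
    through x|n, or t lies above the whole ray of x, and no other branch can reach
    t since branches split into incomparable nodes. *)
Theorem binary_tree_contains_cantor :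
  contains_binary_tree T -> contains_copy_of (ray_space T) cantor_space.
Proof.
move=> [_ [f [_ fE]]].
pose branch (x : cantor_space) n := f (mkseq x n).
have prefix_mkseq (x : cantor_space) m n : (m <= n)%N ->
    prefix (mkseq x m) (mkseq x n).
  by move=> mn; rewrite prefixE size_mkseq /mkseq -map_take take_iota (minn_idPl mn).
have branch_le x m n : (m <= n)%N -> branch x m <= branch x n.
  by move=> mn; rewrite fE prefix_mkseq.
have branch_agree (x y : cantor_space) n :
    (forall i, (i < n)%N -> x i = y i) -> branch x n = branch y n.
  move=> xy; congr f; apply/eq_in_map => i.
  by rewrite mem_iota add0n => /xy.
(* Beyond the digit where x and y differ, their nodes are incomparable, so no
   node u lies above both. *)
have branch_split (x y : cantor_space) n m k u : x n <> y n -> (n < m)%N ->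
    (n < k)%N -> branch x m <= u -> branch y k <= u -> False.
  move=> xyn nm nk xu yu.
  wlog le : x y m k xyn nm nk xu yu / branch x m <= branch y k.
    have [le|le] := tree_comparable treeT xu yu; first by move/(_ x y m k); apply.
    by move/(_ y x k m); apply => //; exact/nesym.
  apply: xyn; move: le; rewrite fE prefixE size_mkseq => /eqP xy.
  have := congr1 (nth false ^~ n) xy; rewrite nth_take// !nth_mkseq//.
have /choice[F FE] : forall x, exists R, nodes R = [set t | exists n, t <= branch x n].
  move=> x; apply: is_ray_nodes; split.
  - by exists (branch x 0); exists 0.
  - by move=> s t st [n tn]; exists n; exact: le_trans tn.
  - move=> s t [n sn] [m tm]; apply: (tree_comparable treeT (u := branch x (maxn n m))).
    + by apply: le_trans sn _; rewrite branch_le// leq_maxl.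
    + by apply: le_trans tm _; rewrite branch_le// leq_maxr.
  - move=> t [n tn]; exists (branch x n.+1); first by exists n.+1.
    apply: le_lt_trans tn _; rewrite lt_neqAle branch_le// andbT.
    apply/eqP => E; have : branch x n.+1 <= branch x n by rewrite -E.
    by rewrite fE => /size_prefix; rewrite !size_mkseq ltnn.
have FP x t : nodes (F x) t <-> exists n, t <= branch x n by rewrite FE.
have Finj : injective F.
  move=> x y Fxy; apply/funext => n; apply: contrapT => xyn.
  have [m ym] : exists m, branch x n.+1 <= branch y m.
    by apply/FP; rewrite -Fxy; apply/FP; exists n.+1.
  apply: (branch_split x y n n.+1 (maxn m n.+1) (branch y (maxn m n.+1)) xyn) => //.
  - by rewrite leq_max ltnS leqnn orbT.
  - by apply: le_trans ym _; rewrite branch_le// leq_maxl.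
(* The branches y through a given node f(x|n) form a neighbourhood of x. *)
have cyl (x : cantor_space) n : nbhs x [set y : cantor_space | branch y n = branch x n].
  suff : nbhs x [set y : cantor_space | forall i, (i < n)%N -> y i = x i].
    by apply: filterS => y; exact: branch_agree.
  elim: n => [|n IH]; first by apply: filterS filterT => y _ i.
  have nx : nbhs x [set y : cantor_space | y n = x n].
    apply: open_nbhs_nbhs; split=> //.
    apply: (@open_comp cantor_space bool (proj n) [set x n]); last exact: discrete_open.
    by move=> z _; exact: proj_continuous.
  apply: filterS (filterI IH nx) => y [yx yn] i; rewrite ltnS leq_eqVlt.
  by move=> /predU1P[->//|/yx].
have Fcont : continuous F.
  apply: ray_continuous => t; rewrite openE => x /= tx; rewrite /interior.
  - have /FP[n tn] := tx; apply: filterS (cyl x n) => y E; apply/FP.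
    by exists n; rewrite E.
  (* Either t lies above the whole ray of x, or some node of it is not below t and
     is then incomparable with t. *)
  - have [below|nbelow] := pselect (forall n, branch x n <= t).
    + apply: filterS filterT => y _ Fy.
      have xy : x <> y by move=> E; apply: tx; rewrite E.
      have [n xyn] : exists n, x n <> y n.
        by apply: contrapT => nn; apply: xy; apply/funext => n; apply: contrapT => ?;
          apply: nn; exists n.
      have /FP[m tm] := Fy.
      apply: (branch_split x y n n.+1 (maxn m n.+1) (branch y (maxn m n.+1)) xyn) => //.
      * by rewrite leq_max ltnS leqnn orbT.
      * apply: le_trans (below _) _; apply: le_trans tm _.
        by rewrite branch_le// leq_maxl.
    + have [n nn] : exists n, ~ branch x n <= t.
        by apply: contrapT => h; apply: nbelow => n; apply: contrapT => ?; apply: h; exists n.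
      apply: filterS (cyl x n) => y E /FP[m tm].
      have xnm : branch x n <= branch y (maxn n m).
        by rewrite -E branch_le// leq_maxl.
      have tnm : t <= branch y (maxn n m).
        by apply: le_trans tm _; rewrite branch_le// leq_maxr.
      have [//|le] := tree_comparable treeT xnm tnm.
      by apply: tx; apply/FP; exists n.
(* Images of closed sets are compact, hence closed, so F is open onto its range. *)
exists F; split=> // U oU; exists (~` (F @` ~` U)).
  rewrite openC; apply: (compact_closed (@ray_space_hausdorff _ T)).
  apply: continuous_compact; first exact: continuous_subspaceT.
  apply: (subclosed_compact _ cantor_space_compact); last by [].
  exact: open_closedC.
rewrite -[RHS]/(_ `&` range F); apply/seteqP; split=> [_ [x Ux <-]|R [nR [x _ xR]]].
  by split; [move=> [y nUy /Finj E]; apply: nUy; rewrite E|exists x].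
by exists x => //; apply: contrapT => nUx; apply: nR; exists x.
Qed.

(** If A has no isolated point, then above every node lying on a ray of A there are
    two incomparable nodes lying on rays of A. *)
Theorem no_binary_tree_scattered :
  ~ contains_binary_tree T -> scattered (ray_space T).
Proof.
move=> nbT A A0; pose meets t := exists2 R, A R & nodes R t.
have [t [[R0 AR0 R0t] chn]] : exists t, meets t /\
    forall s u, t <= s -> t <= u -> meets s -> meets u -> s <= u \/ u <= s.
  apply: contrapT => nt; apply: nbT.
    apply: (splitting_contains_binary_tree treeT (P := meets)).
    have [R AR] := A0; have [[t Rt] _ _ _] := nodes_is_ray R.
    by exists t; exists R.
  move=> t mt; apply: contrapT => ns; apply: nt; exists t; split=> // s u ts tu ms mu.
  by apply: contrapT => inc; apply: ns; exists s, u.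
(* D consists of the nodes that separate two rays of A through t.  Above t the
   nodes meeting A are linearly ordered, so D has a least element if it is
   nonempty, and a ray of A through t avoiding D is the only one to do so. *)
pose D := [set u | meets u /\ t <= u /\ exists R, [/\ A R, nodes R t & ~ nodes R u]].
have DP R R' u : A R -> A R' -> nodes R t -> nodes R' t -> nodes R u ->
    ~ nodes R' u -> D u.
  move=> AR AR' Rt R't Ru nR'u; split; first by exists R.
  split; last by exists R'.
  have [//|ut] := nodes_total Rt Ru.
  by case: nR'u; exact: nodes_down R't.
have isolate (V : set (ray_space T)) R : open V -> V R -> A R -> nodes R t ->
    (forall R', A R' -> V R' -> nodes R' t /\ nodes R' `&` D `<=` nodes R) ->
    (nodes R `&` D = set0) -> isolated A !=set0.
  move=> oV VR AR Rt VA RD; exists R; split; first exact: mem_set.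
  exists V; first exact: open_nbhs_nbhs.
  apply/seteqP; split=> [R' [VR' AR']|_ ->] //.
  have [R't R'D] := VA R' AR' VR'.
  apply: nodes_inj; apply/seteqP; split=> u uR; apply: contrapT => nu.
  - by apply: (nu); apply: R'D; split=> //; exact: (DP R' R).
  - have : (nodes R `&` D) u by split=> //; exact: (DP R R').
    by rewrite RD.
(* If D is empty, only one ray of A passes through t. *)
have [D0|D0] := pselect (D !=set0); last first.
  apply: (isolate (cone t) R0) => //; first exact: cone_open.
  - by move=> R' _ R't; split=> // u [_ Du]; case: D0; exists u.
  - by apply/seteqP; split=> // u [_ Du]; case: D0; exists u.
have [|u [_ [tu [R [AR Rt nRu]]]] uD] := chain_least treeT D0.
  by move=> s v [ms [ts _]] [mv [tv _]]; exact: chn.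
have out R' : ~ nodes R' u -> nodes R' `&` D = set0.
  move=> nu; apply/seteqP; split=> // v [R'v Dv]; apply: nu.
  exact: nodes_down (uD v Dv) R'v.
apply: (isolate (cone t `&` ~` cone u) R) => //; last exact: out.
- by apply: openI; [exact: cone_open|exact: setC_cone_open].
- by move=> R' _ [R't R'u]; split=> //; rewrite (out R').
Qed.

(** The sets [s], for s an immediate successor of t, partition [t] into open sets,
    which are nonempty in a pruned tree.  Hence a countable cover by these and the
    complement of [t] has to use all of them. *)
Theorem pruned_lindelof_countably_branching :
  pruned T -> lindelof (ray_space T) -> countably_branching T.
Proof.
move=> prT lindT t; pose S := immediate_successors t.
have raythrough s : exists R, nodes R s.
  by have [C [rayC Cs]] := prT s; have [R RE] := is_ray_nodes rayC; exists R; rewrite RE.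
have cone_inj s u : S s -> S u -> forall R, nodes R s -> nodes R u -> s = u.
  move=> Ss Su R Rs Ru; apply: comparable_immediate_successors Ss Su _.
  exact: nodes_total Rs Ru.
have [|V [VU /countable_injP[e injE] VT]] :=
    lindT (@cone _ T @` S `|` [set ~` cone t]).
  split; first by exists (~` cone t); right.
  - move=> _ [[s _ <-]|->]; [exact: cone_open|exact: setC_cone_open].
  - rewrite -subTset => R _; have [Rt|nRt] := pselect (nodes R t).
      have [s Rs Ss] := ray_immediate_successor treeT (nodes_is_ray R) Rt.
      by exists (cone s) => //; left; exists s.
    by exists (~` cone t) => //; right.
have VS s : S s -> V (cone s).
  move=> Ss; have [R Rs] := raythrough s.
  have [B VB BR] : (\bigcup_(B in V) B) R by rewrite VT.
  have [[u Su uB]|BE] := VU B VB.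
    by move: BR VB; rewrite -uB => Ru; rewrite (cone_inj _ _ Ss Su R).
  move: BR; rewrite BE; case; case: Ss => ts _.
  exact: nodes_down (ltW ts) Rs.
apply/countable_injP; exists (e \o @cone _ T) => s u /set_mem Ss /set_mem Su /= E.
have [R Rs] := raythrough s.
have cE : cone s = cone u by apply: injE E; rewrite inE; exact: VS.
have Ru : cone u R by rewrite -cE.
exact: (cone_inj s u Ss Su R).
Qed.

(** The nodes t for which [t] is not countably covered would contain a ray; but
    near a ray the cover leaves out only finitely many sets [s], all of them off
    the ray, and these can be countably covered. *)
Theorem countably_branching_lindelof :
  rooted T -> countably_branching T -> lindelof (ray_space T).
Proof.
move=> [r rle] cbT U [_ Uop UT]; apply: contrapT => nlind.
pose bad t := ~ countably_covered U (cone t).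
have bad_root : bad r.
  move=> [V [VU cV rV]]; apply: nlind; exists V; split=> //.
  rewrite -subTset => R _; apply: rV.
  by have [[t Rt] _ _ _] := nodes_is_ray R; exact: nodes_down (rle t) Rt.
have bad_down s t : s <= t -> bad t -> bad s.
  move=> st bt cs; apply: bt; apply: sub_countably_covered cs => R.
  exact: nodes_down.
have bad_succ t : bad t -> exists2 s, t < s & bad s.
  move=> bt; apply: contrapT => ns; apply: bt.
  have : countably_covered U (\bigcup_(s in immediate_successors t) cone s).
    apply: countably_covered_bigcup => [|s [ts _]]; first exact: cbT.
    by apply: contrapT => bs; apply: ns; exists s.
  apply: sub_countably_covered => R Rt.
  have [s Rs ts] := ray_immediate_successor treeT (nodes_is_ray R) Rt.
  by exists s.
have [M [Mbad Mtot Mmax]] := maximal_chain_in bad.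
have Mnomax t : M t -> exists2 s, M s & t < s.
  move=> Mt; apply: contrapT => ns.
  have topM s : M s -> s <= t.
    move=> Ms; have [//|ts] := Mtot s t Ms Mt.
    move: ts; rewrite le_eqVlt => /predU1P[->//|ts].
    by case: ns; exists s.
  have [s ts bs] := bad_succ t (Mbad t Mt).
  apply: ns; exists s => //.
  by apply: Mmax => // u /topM ut; left; exact: le_trans ut (ltW ts).
(* A bad upper bound of M would belong to M by maximality, and be its largest
   element. *)
have no_bad_above s : (forall t, M t -> t <= s) -> ~ bad s.
  move=> Ms bs; have /Mnomax[u Mu su] : M s by apply: Mmax => // t /Ms; left.
  by have := lt_le_trans su (Ms u Mu); rewrite ltxx.
have Mr : M r by apply: Mmax => // s _; right.
have Mray : is_ray M.
  split=> //; first by exists r.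
  move=> s t st Mt; apply: Mmax; first exact: bad_down (Mbad t Mt).
  move=> u Mu; have [ut|tu] := Mtot u t Mu Mt.
    exact: tree_comparable ut st.
  by right; exact: le_trans tu.
have [R RM] := is_ray_nodes Mray.
have [O UO OR] : (\bigcup_(O in U) O) R by rewrite UT.
have [t [Mt [l lM lO]]] := nbhs_ray (open_nbhs_nbhs (conj (Uop _ UO) OR)).
rewrite RM in Mt lM.
(* A node s of l either bounds M, in which case it is not bad, or is incomparable
   with some v in M, in which case [v] and [s] are disjoint. *)
have [u [Mu tu cu]] : exists u, [/\ M u, t <= u &
    countably_covered U (cone u `&` \bigcup_(s in [set` l]) cone s)].
  elim: l lM {lO} => [|s l IH] lM.
    exists t; split=> //; apply: sub_countably_covered (countably_covered0 U).
    by move=> ? [_ []].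
  have [|u [Mu tu cu]] := IH; first by move=> v vl; apply: lM; rewrite inE vl orbT.
  have [v [Mv cv]] : exists v, M v /\ countably_covered U (cone v `&` cone s).
    have [above|nabove] := pselect (forall v, M v -> v <= s).
      exists r; split=> //; have /contrapT := no_bad_above s above.
      by apply: sub_countably_covered => ? [].
    have [v [Mv nvs]] : exists v, M v /\ ~ v <= s.
      by apply: contrapT => h; apply: nabove => v Mv; apply: contrapT => ?; apply: h; exists v.
    exists v; split=> //; apply: sub_countably_covered (countably_covered0 U).
    move=> R' [R'v R's]; have [//|sv] := nodes_total R'v R's.
    have [_ downM _ _] := Mray.
    by apply: (lM s); [rewrite mem_head|exact: downM Mv].
  have [w [Mw uw vw]] : exists w, [/\ M w, u <= w & v <= w].
    by have [uv|vu] := Mtot u v Mu Mv; [exists v|exists u].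
  exists w; split=> //; first exact: le_trans uw.
  apply: sub_countably_covered (countably_coveredU cu cv).
  move=> R' [R'w [z /=]]; rewrite inE => /predU1P[->|zl] R'z.
    by right; split=> //; exact: nodes_down R'w.
  by left; split; [exact: nodes_down R'w|exists z].
apply: (Mbad u Mu).
apply: sub_countably_covered (countably_coveredU cu (countably_covered1 UO)) => R' R'u.
have [sR'|nR'] := pselect ((\bigcup_(s in [set` l]) cone s) R'); first by left.
right; apply: lO; first exact: nodes_down R'u.
by move=> s sl R's; apply: nR'; exists s.
Qed.

End RayTree.

(** * The equivalence *)

Theorem theorem4p8 (d : Order.disp_t) (T : porderType d)
    (treeT : order_tree T) (rootT : rooted T) :
  [<-> rothberger (ray_space T);
       lindelof (ray_space T) /\ ~ contains_copy_of (ray_space T) cantor_space;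
       lindelof (ray_space T) /\ ~ contains_binary_tree T;
       lindelof (ray_space T) /\ scattered (ray_space T)]
  /\
  (pruned T ->
   [<-> rothberger (ray_space T);
        countably_branching T /\
          ~ contains_copy_of (ray_space T) cantor_space;
        countably_branching T /\ ~ contains_binary_tree T;
        countably_branching T /\ scattered (ray_space T)]).
Proof.
have ab : rothberger (ray_space T) ->
    lindelof (ray_space T) /\ ~ contains_copy_of (ray_space T) cantor_space.
  move=> rothT; split; first exact: rothberger_lindelof.
  by apply: rothberger_no_cantor => //; exact: ray_space_hausdorff.
have bc : ~ contains_copy_of (ray_space T) cantor_space ->
    ~ contains_binary_tree T.
  exact/contra_not/binary_tree_contains_cantor.
have cd := no_binary_tree_scattered treeT.
have da : lindelof (ray_space T) /\ scattered (ray_space T) ->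
    rothberger (ray_space T).
  case; apply: regular_lindelof_scattered_rothberger.
  exact: ray_space_regular.
split=> [|prT].
  by tfae => // -[lindT]; [move/bc|move/cd].
tfae.
- move=> /ab[lindT nC]; split=> //.
  exact: pruned_lindelof_countably_branching.
- by case=> cbT /bc.
- by case=> cbT /cd.
- case=> cbT scatT; apply: da; split=> //.
  exact: countably_branching_lindelof.
Qed.
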